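(* Let $S$ be a restriction semigroup, $Y$ a semilattice, $q\colon Y\to P(S)$ a morphism of semilattices and $\varphi\colon S\to\mathcal{I}(Y)$, $s\mapsto\varphi_s$, a premorphism, such that: (A1) for all $s\in S$, $\operatorname{dom}\varphi_s$ and $\operatorname{ran}\varphi_s$ are order ideals of $Y$; (A2) for all $s\in S$, $\varphi_s$ is an order isomorphism (from its domain onto its range); (A3) for all $e\in P(S)$, $(q^{-1}(e))^\downarrow\subseteq\operatorname{dom}\varphi_e\subseteq q^{-1}(e^\downarrow)$; (A4) for all $s\in S$, $\operatorname{dom}\varphi_s\cap\{y\in Y\colon q(y)=s^*\}\ne\varnothing$. Then the partial action product $(Y\rtimes^q_\varphi S;\cdot,{}^*,{}^+)$ of $Y$ by $S$ with respect to $\varphi$ and $q$ is a restriction semigroup.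
   Context: A restriction semigroup is an algebra $(S;\cdot,{}^*,{}^+)$ of type $(2,1,1)$ such that $(S;\cdot)$ is a semigroup and the following identities hold: $x^+x=x$, $x^+y^+=y^+x^+$, $(x^+y)^+=x^+y^+$, $(xy)^+x=xy^+$; $xx^*=x$, $x^*y^*=y^*x^*$, $(xy^* )^*=x^*y^*$, $y(xy)^*=x^*y$; $(x^+)^*=x^+$, $(x^* )^+=x^*$. $P(S)=\{s^*\colon s\in S\}=\{s^+\colon s\in S\}$ is the semilattice of projections. The natural partial order is: $s\le t$ iff $s=et$ for some $e\in P(S)$. Inverse semigroups are restriction semigroups via $s^*=s^{-1}s$, $s^+=ss^{-1}$. $\mathcal{I}(Y)$ is the symmetric inverse semigroup of all partial bijections of $Y$, composed from right to left. For a subset $B$ of a poset, $B^\downarrow$ is the set of elements lying below some element of $B$, and $b^\downarrow=\{b\}^\downarrow$. A premorphism $\varphi\colon S\to T$ between restriction semigroups is a map with $\varphi(s)\varphi(t)\le\varphi(st)$, $\varphi(s)^*\le\varphi(s^* )$ and $\varphi(s)^+\le\varphi(s^+)$ for all $s,t\in S$. The partial action product $Y\rtimes^q_\varphi S$ has underlying set $\{(y,s)\in Y\times S\colon y\in\operatorname{ran}\varphi_s\text{ and }q(y)=s^+\}$, multiplication $(y,s)(x,t)=(\varphi_s(\varphi_s^{-1}(y)\wedge x),st)$ and unary operations $(y,s)^*=(\varphi_s^{-1}(y),s^* )$, $(y,s)^+=(y,s^+)$ (under (A1)–(A4) these operations are well defined on this set). *)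

(* Defs.v *)
From mathcomp Require Import all_boot all_order.
From mathcomp Require Import boolp classical_sets.
Import Order.TTheory.

Set Implicit Arguments.
Unset Strict Implicit.
Unset Printing Implicit Defensive.

Local Open Scope classical_set_scope.
Local Open Scope order_scope.

Record restriction_semigroup (S : Type) (mul : S -> S -> S)
    (star plus : S -> S) : Prop := RestrictionSemigroup {
  rs_mulA : associative mul;
  rs_plus_mul : forall x, mul (plus x) x = x;
  rs_plusC : forall x y, mul (plus x) (plus y) = mul (plus y) (plus x);
  rs_plus_plusM : forall x y,
    plus (mul (plus x) y) = mul (plus x) (plus y);
  rs_plusM_mul : forall x y, mul (plus (mul x y)) x = mul x (plus y);
  rs_mul_star : forall x, mul x (star x) = x;
  rs_starC : forall x y, mul (star x) (star y) = mul (star y) (star x);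
  rs_starM_star : forall x y,
    star (mul x (star y)) = mul (star x) (star y);
  rs_mul_starM : forall x y, mul y (star (mul x y)) = mul (star x) y;
  rs_star_plus : forall x, star (plus x) = plus x;
  rs_plus_star : forall x, plus (star x) = star x }.

(* The carrier is a bare [Type]: MathComp's [semigroupType] would also demand a
   choice structure on it. *)
Structure restrSemigroup := RestrSemigroup {
  rs_sort :> Type;
  rmul : rs_sort -> rs_sort -> rs_sort;
  rstar : rs_sort -> rs_sort;
  rplus : rs_sort -> rs_sort;
  rs_axioms : restriction_semigroup rmul rstar rplus }.

Arguments rmul {r}.
Arguments rstar {r}.
Arguments rplus {r}.

Definition proj (S : restrSemigroup) : set S := range (@rstar S).
Arguments proj : clear implicits.

Definition rs_le (S : restrSemigroup) (s t : S) : Prop :=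
  exists2 e, proj S e & s = rmul e t.

Definition premorphism (S T : restrSemigroup) (f : S -> T) : Prop :=
  [/\ forall s t, rs_le (rmul (f s) (f t)) (f (rmul s t)),
      forall s, rs_le (rstar (f s)) (f (rstar s))
    & forall s, rs_le (rplus (f s)) (f (rplus s))].

Definition down_closure (T : Type) (le : T -> T -> Prop) (B : set T) : set T :=
  [set x | exists2 b, B b & le x b].

(* A partial bijection is stored together with its inverse, [None] meaning
   "undefined"; the inverse is determined by the map. *)
Record pbij (Y : Type) := PBij {
  pfun :> Y -> option Y;
  pinvfun : Y -> option Y;
  pfunP : forall x y, pfun x = Some y <-> pinvfun y = Some x }.

Section PartialBijections.
Variable Y : Type.
Implicit Types f g h : pbij Y.

Lemma pinv_subproof f x y : pinvfun f x = Some y <-> pfun f y = Some x.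
Proof. by split=> /pfunP. Qed.

Definition pinv f : pbij Y := PBij (pinv_subproof f).

Lemma pcomp_subproof f g x y :
  obind (pfun f) (pfun g x) = Some y <->
  obind (pinvfun g) (pinvfun f y) = Some x.
Proof.
split.
- case E: (pfun g x) => [z|] //= /pfunP ->; exact/pfunP.
- case E: (pinvfun f y) => [z|] //= /pfunP ->; exact/pfunP.
Qed.

(* Right to left: [pcomp f g] applies [g] first. *)
Definition pcomp f g : pbij Y := PBij (pcomp_subproof f g).

Definition pstar f : pbij Y := pcomp (pinv f) f.
Definition pplus f : pbij Y := pcomp f (pinv f).

Definition dom f : set Y := [set x | isSome (f x)].
Definition ran f : set Y := dom (pinv f).

Lemma ranE f : ran f = [set y | exists x, f x = Some y].
Proof.
apply/seteqP; split=> y; rewrite /ran /dom /=.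
- by case E: (pinvfun f y) => [x|] // _; exists x; apply/pfunP.
- by case=> x /pfunP ->.
Qed.

Definition papp f x : dom f x -> Y :=
  match f x as o return isSome o -> Y with
  | Some y => fun=> y
  | None => fun no => False_rect Y (not_false_is_true no)
  end.

Lemma pappE f x (hx : dom f x) : f x = Some (papp hx).
Proof. by rewrite /papp; move: hx; rewrite /dom /=; case: (pfun f x). Qed.

Lemma pbij_inj f x x' y : f x = Some y -> f x' = Some y -> x = x'.
Proof. by move=> /pfunP E /pfunP; rewrite E => -[]. Qed.

Lemma pbij_eq f g : (forall x y, f x = Some y <-> g x = Some y) -> f = g.
Proof.
case: f g => [f f' fP] [g g' gP] /= fg.
have ? : f = g.
  apply/funext => x; case E: (f x) => [y|]; first by apply/esym/fg.
  by case E': (g x) => [y|] //; move/fg: E'; rewrite E.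
subst g; have ? : f' = g'.
  apply/funext => y; case E: (f' y) => [x|]; first by apply/esym/gP/fP.
  by case E': (g' y) => [x|] //; move/gP/fP: E'; rewrite E.
by subst g'; congr PBij; apply: Prop_irrelevance.
Qed.

Lemma pcompP f g x y :
  pcomp f g x = Some y <-> exists2 z, g x = Some z & f z = Some y.
Proof.
rewrite /=; split; last by case=> z ->.
by case: (pfun g x) => [z|] //= E; exists z.
Qed.

Lemma pstarP f x y : pstar f x = Some y <-> x = y /\ exists z, f x = Some z.
Proof.
rewrite pcompP; split=> [[z fx /pinv_subproof fy]|[<- [z fx]]].
  by split; [apply: pbij_inj fx fy | exists z].
by exists z => //; apply/pinv_subproof.
Qed.

Lemma pplusP f x y : pplus f x = Some y <-> x = y /\ exists z, f z = Some x.
Proof.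
rewrite pcompP; split=> [[z /pinv_subproof fz]|[<- [z fz]]].
  by rewrite fz => -[<-]; split=> //; exists z.
by exists z => //; apply/pinv_subproof.
Qed.

Lemma pbij_restriction_semigroup : restriction_semigroup pcomp pstar pplus.
Proof.
split=> [f g h|f|f g|f g|f g|f|f g|f g|f g|f|f]; apply: pbij_eq => x y.
- by rewrite /=; case: (pfun h x).
- rewrite pcompP; split=> [[z fx /pplusP[<- _]] //|fx].
  by exists y => //; apply/pplusP; split=> //; exists x.
- by rewrite !pcompP; split=> -[_ /pplusP[<- ?] /pplusP[<- ?]];
    exists x; apply/pplusP.
- rewrite pplusP pcompP; split.
    case=> <- [z /pcompP[w gz /pplusP[wx [u fu]]]]; move: wx fu gz => -> fu gz.
    by exists x; apply/pplusP; split=> //; [exists z | exists u].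
  case=> _ /pplusP[<- [z gz]] /pplusP[<- [u fu]]; split=> //; exists z.
  by apply/pcompP; exists x => //; apply/pplusP; split=> //; exists u.
- rewrite !pcompP; split.
    case=> z fx /pplusP[<- [w /pcompP[v gw fv]]]; exists x => //.
    by apply/pplusP; split=> //; exists w; rewrite (pbij_inj fx fv).
  case=> _ /pplusP[<- [w gw]] fx; exists y => //.
  by apply/pplusP; split=> //; exists w; apply/pcompP; exists x.
- rewrite pcompP; split=> [[_ /pstarP[<- _]] //|fx].
  by exists x => //; apply/pstarP; split=> //; exists y.
- by rewrite !pcompP; split=> -[_ /pstarP[<- ?] /pstarP[<- ?]];
    exists x; apply/pstarP.
- rewrite pstarP pcompP; split.
    case=> <- [z /pcompP[_ /pstarP[<- [w gx]] fx]].
    by exists x; apply/pstarP; split=> //; [exists w | exists z].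
  case=> _ /pstarP[<- [w gx]] /pstarP[<- [z fx]]; split=> //; exists z.
  by apply/pcompP; exists x => //; apply/pstarP; split=> //; exists w.
- rewrite !pcompP; split.
    case=> _ /pstarP[<- [w /pcompP[v gx fv]]] gx'; exists y => //.
    by apply/pstarP; split=> //; exists w; move: gx; rewrite gx' => -[->].
  case=> z gx /pstarP[<- [w fz]]; exists x => //.
  by apply/pstarP; split=> //; exists w; apply/pcompP; exists z.
- rewrite pstarP; split=> [[<- [z /pplusP[_ H]]]|/pplusP[<- H]].
    by apply/pplusP.
  by split=> //; exists x; apply/pplusP.
- rewrite pplusP; split=> [[<- [z /pstarP[<- H]]]|/pstarP[<- H]].
    by apply/pstarP.
  by split=> //; exists x; apply/pstarP.
Qed.

(* The symmetric inverse semigroup, with [f^* = f^-1 f] and [f^+ = f f^-1]. *)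
Canonical symInv : restrSemigroup := RestrSemigroup pbij_restriction_semigroup.

End PartialBijections.

Arguments symInv : clear implicits.

Definition order_ideal (d : Order.disp_t) (Y : porderType d) (I : set Y) :
    Prop :=
  forall x y, I y -> x <= y -> I x.

Definition order_iso (d : Order.disp_t) (Y : porderType d) (f : pbij Y) :
    Prop :=
  forall x x' (hx : dom f x) (hx' : dom f x'),
    (papp hx <= papp hx') = (x <= x').

(* The meet of the semilattice [proj S] is the product of [S]. *)
Definition proj_morphism (d : Order.disp_t) (Y : meetSemilatticeType d)
    (S : restrSemigroup) (q : Y -> S) : Prop :=
  (forall y, proj S (q y)) /\ (forall x y, q (x `&` y) = rmul (q x) (q y)).

Section RestrSemigroupTheory.
Variable S : restrSemigroup.
Implicit Types s t e f : S.

Local Notation A := (rs_axioms S).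

Lemma proj_star e : proj S e -> rstar e = e.
Proof.
case=> s _ <-.
by rewrite -{1}(rs_plus_star A s) (rs_star_plus A) (rs_plus_star A).
Qed.

Lemma proj_plus e : proj S e -> rplus e = e.
Proof. by case=> s _ <-; rewrite (rs_plus_star A). Qed.

Lemma projC e f : proj S e -> proj S f -> rmul e f = rmul f e.
Proof. by case=> s _ <- [t _ <-]; apply: (rs_starC A). Qed.

Lemma projplus s : proj S (rplus s).
Proof. by exists (rplus s) => //; apply: (rs_star_plus A). Qed.

Lemma projstar s : proj S (rstar s).
Proof. by exists s. Qed.

Lemma proj_idem e : proj S e -> rmul e e = e.
Proof. by move=> he; rewrite -{2}(proj_star he) (rs_mul_star A). Qed.

Lemma plus_mulplus s t : rplus (rmul s (rplus t)) = rplus (rmul s t).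
Proof.
rewrite -(rs_plusM_mul A) (rs_plus_plusM A).
rewrite -(rs_plus_plusM A) (rs_plusM_mul A).
have <- : rmul (rplus s) (rmul s t) = rmul s t.
  by rewrite (rs_mulA A) (rs_plus_mul A).
rewrite (rs_plus_plusM A) (rs_plusC A) -(rs_plus_plusM A) (rs_plusM_mul A).
by rewrite ?(rs_plus_plusM A).
Qed.

(* The identity behind [q (phi s z) = (s (q z))^+]. *)
Lemma fibre_transport s e f : proj S e -> proj S f ->
  rmul f (rplus (rmul s e)) = f -> rmul e (rstar (rmul f s)) = e ->
  rplus (rmul s e) = f.
Proof.
move=> he hf hfs hes.
have E : rmul s e = rmul f (rmul s e).
  rewrite -{1}hes (projC he (projstar _)) (rs_mulA A) (rs_mul_starM A).
  by rewrite (proj_star hf) -(rs_mulA A).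
by rewrite E -{1}(proj_plus hf) (rs_plus_plusM A) (proj_plus hf).
Qed.

End RestrSemigroupTheory.

Lemma rs_le_symInv (Y : Type) (f g : symInv Y) x y :
  rs_le f g -> (f : pbij Y) x = Some y -> (g : pbij Y) x = Some y.
Proof. by case=> e [h _ <-] -> /pcompP[z gx /pstarP[<- _]]. Qed.

Section PartialActionProduct.
Variables (S : restrSemigroup) (d : Order.disp_t) (Y : meetSemilatticeType d).
Variables (q : Y -> S) (phi : S -> symInv Y).

Definition pap_set : set (Y * S) :=
  [set p | ran (phi p.2) p.1 /\ q p.1 = rplus p.2].

Definition pap : Type := {p : Y * S | pap_set p}.

Hypothesis q_morph : proj_morphism q.
Hypothesis phi_premorph : premorphism phi.
Hypothesis phi_ideal :
  forall s, order_ideal (dom (phi s)) /\ order_ideal (ran (phi s)).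
Hypothesis phi_fibre : forall e, proj S e ->
  (down_closure (fun x y => (x <= y)%O) (q @^-1` [set e])
     `<=` dom (phi e))%classic /\
  (dom (phi e) `<=` q @^-1` down_closure (@rs_le S) [set e])%classic.

Local Notation A := (rs_axioms S).

Lemma phiM s t x y z :
  phi t x = Some y -> phi s y = Some z -> phi (rmul s t) x = Some z.
Proof.
case: phi_premorph => M _ _ tx sy; apply: (rs_le_symInv (M s t)).
by apply/pcompP; exists y.
Qed.

Lemma phi_star s x y : phi s x = Some y -> phi (rstar s) x = Some x.
Proof.
case: phi_premorph => _ M _ sx; apply: (rs_le_symInv (M s)).
by apply/pstarP; split=> //; exists y.
Qed.

Lemma phi_plus s x y : phi s x = Some y -> phi (rplus s) y = Some y.
Proof.
case: phi_premorph => _ _ M sx; apply: (rs_le_symInv (M s)).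
by apply/pplusP; split=> //; exists x.
Qed.

Lemma phi_q x : phi (q x) x = Some x.
Proof.
have [qP _] := q_morph.
have [/(_ x) H _] := phi_fibre (qP x).
have hx : dom (phi (q x)) x by apply: H; exists x.
by rewrite -[q x](proj_star (qP x)) (phi_star (pappE hx)).
Qed.

Lemma q_le e x y : proj S e -> phi e x = Some y -> rmul (q x) e = q x.
Proof.
move=> he ex; have [_ /(_ x) H] := phi_fibre he.
have [|_ -> [f hf ->]] := H; first by rewrite /dom /= ex.
by rewrite -(rs_mulA A) proj_idem.
Qed.

Lemma q_phi s x y : phi s x = Some y -> q y = rplus (rmul s (q x)).
Proof.
have [qP _] := q_morph.
move=> sx; apply/esym/fibre_transport => //.
- by apply: q_le (projplus _) _; apply/phi_plus/(phiM _ sx)/phi_q.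
- by apply: q_le (projstar _) _; apply/phi_star/(phiM sx)/phi_q.
Qed.

Lemma q_phiV s x y : phi s x = Some y -> q y = rplus s -> q x = rstar s.
Proof.
have [qP _] := q_morph.
move=> sx qy; have Ex : rmul (rstar s) (q x) = q x.
  rewrite projC //; last exact: projstar.
  by apply: q_le (projstar _) (phi_star sx).
have Es : rmul s (q x) = s.
  rewrite -[RHS](rs_plus_mul A) -qy (q_phi sx) (rs_plusM_mul A).
  by rewrite proj_plus.
by rewrite -Ex -{1}(proj_star (qP x)) -(rs_starM_star A) (proj_star (qP x)) Es.
Qed.

Lemma pap_ran (a : pap) : dom (pinv (phi (sval a).2)) (sval a).1.
Proof. by case: a => a []. Qed.

Lemma pap_q (a : pap) : q (sval a).1 = rplus (sval a).2.
Proof. by case: a => a []. Qed.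

Definition pap_inv (a : pap) : Y := papp (pap_ran a).

Lemma pap_invE a : phi (sval a).2 (pap_inv a) = Some (sval a).1.
Proof. by apply/pinv_subproof; apply: (pappE (pap_ran a)). Qed.

Lemma pap_mul_dom (a b : pap) :
  dom (phi (sval a).2) (pap_inv a `&` (sval b).1).
Proof.
have [I _] := phi_ideal (sval a).2.
by apply: I (leIl _ _); rewrite /dom /= pap_invE.
Qed.

Lemma pap_mul_subproof (a b : pap) :
  pap_set (papp (pap_mul_dom a b), rmul (sval a).2 (sval b).2).
Proof.
have [qP qM] := q_morph.
have /= E := pappE (pap_mul_dom a b).
set w := papp _ in E *; set z := Order.meet _ _ in E.
have [I J] := phi_ideal (sval b).2.
have : ran (phi (sval b).2) z by apply: J (leIr _ _); apply: pap_ran.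
rewrite ranE => -[v bv]; split=> /=.
  by rewrite ranE; exists v; apply: phiM bv E.
rewrite (q_phi E) qM (q_phiV (pap_invE a) (pap_q a)) pap_q.
by rewrite (rs_mulA A) (rs_mul_star A) plus_mulplus.
Qed.

Lemma pap_star_subproof (a : pap) : pap_set (pap_inv a, rstar (sval a).2).
Proof.
split=> /=; last first.
  by rewrite (q_phiV (pap_invE a) (pap_q a)) (rs_plus_star A).
by rewrite ranE; exists (pap_inv a); apply: phi_star (pap_invE a).
Qed.

Lemma pap_plus_subproof (a : pap) : pap_set ((sval a).1, rplus (sval a).2).
Proof.
split=> /=; last by rewrite (proj_plus (projplus _)) pap_q.
by rewrite ranE; exists (sval a).1; apply: phi_plus (pap_invE a).
Qed.

(* The partial maps are applied at points proved to lie in their domains, so no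
   default values occur. *)
Definition pap_mul (a b : pap) : pap := exist _ _ (pap_mul_subproof a b).
Definition pap_star (a : pap) : pap := exist _ _ (pap_star_subproof a).
Definition pap_plus (a : pap) : pap := exist _ _ (pap_plus_subproof a).

End PartialActionProduct.

(* Main.v *)
Require Import Defs.
From mathcomp Require Import all_boot all_order.
From mathcomp Require Import boolp classical_sets.

(** An element [(y, s)] of the product is best read as an arrow [x -> y] with
    label [s], where [phi s x = y]; here [x] is [pap_inv].  The product of
    [x -> y] (label [s]) and [x' -> y'] (label [t]) restricts both arrows along
    [x `&` y'] and composes what is left, as in the inductive product of an
    inductive category.  So the source of [a b] is the preimage of
    [x `&` y'] under [phi t] and its target is the image under [phi s]: these
    two facts, [pap_mul_target] and [pap_mul_source], are the only access to the
    product that is needed.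

    Every identity splits into its two coordinates.  On labels it is the same
    identity in [S].  On targets it is a computation with meets, which rests on
    two facts: each [phi s], being an order isomorphism between order ideals,
    preserves order and meets ([phi_leE], [phi_meet]); and the premorphism
    conditions make [phi (s^+)] and [phi (s^* )] fix the targets, respectively
    the sources, of arrows with label [s], so that multiplying by a projection
    only takes meets.  In associativity, both triple products have as target
    the image under [phi s] of the meet of the source of [a] with the target of
    [b c]. *)

Local Open Scope order_scope.
Local Open Scope classical_set_scope.

Section PartialActionProductTheory.

Set Implicit Arguments.
Unset Strict Implicit.
Import Order.TTheory.
Local Open Scope order_scope.

Variables (S : restrSemigroup) (d : Order.disp_t) (Y : meetSemilatticeType d).
Variables (q : Y -> S) (phi : S -> symInv Y).
Hypothesis q_morph : proj_morphism q.
Hypothesis phi_premorph : premorphism phi.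
Hypothesis A1 :
  forall s, order_ideal (dom (phi s)) /\ order_ideal (ran (phi s)).
Hypothesis A2 : forall s, order_iso (phi s).
Hypothesis A3 : forall e, proj S e ->
  (down_closure (fun x y => (x <= y)%O) (q @^-1` [set e])
     `<=` dom (phi e))%classic /\
  (dom (phi e) `<=` q @^-1` down_closure (@rs_le S) [set e])%classic.

Local Notation A := (rs_axioms S).
Local Notation Pmul := (pap_mul q_morph phi_premorph A1 A3).
Local Notation Pstar := (pap_star q_morph phi_premorph A3).
Local Notation Pplus := (@pap_plus S d Y q phi phi_premorph).

Implicit Types (s t : S) (x y z : Y) (a b c : pap q phi).

Lemma phi_leE s x x' y y' :
  phi s x = Some y -> phi s x' = Some y' -> (y <= y') = (x <= x').
Proof.
move=> sx sx'.
have hx : dom (phi s) x by rewrite /dom /= sx.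
have hx' : dom (phi s) x' by rewrite /dom /= sx'.
move: (A2 hx hx'); have := pappE hx; have := pappE hx'.
by rewrite sx sx' => -[<-] [<-].
Qed.

Lemma phi_dom_le s x x' y :
  phi s x = Some y -> x' <= x -> exists y', phi s x' = Some y'.
Proof.
move=> sx le_x'x; have [I _] := A1 s.
have hx' : dom (phi s) x' by apply: I le_x'x; rewrite /dom /= sx.
by exists (papp hx'); apply: pappE.
Qed.

Lemma phi_ran_le s x y y' :
  phi s x = Some y -> y' <= y -> exists x', phi s x' = Some y'.
Proof.
move=> sx le_y'y; have [_ J] := A1 s.
have : ran (phi s) y' by apply: J le_y'y; rewrite ranE; exists x.
by rewrite ranE.
Qed.

(** The domain is a lower set, so [x `&` x'] has an image; the range is a lower
    set, so [y `&` y'] has a preimage.  Comparing the two through the order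
    isomorphism shows that they correspond. *)
Lemma phi_meet s x x' y y' :
  phi s x = Some y -> phi s x' = Some y' ->
  phi s (x `&` x') = Some (y `&` y').
Proof.
move=> sx sx'.
have [w sw] := phi_dom_le sx (leIl x x').
have [v sv] := phi_ran_le sx (leIl y y').
rewrite sw; congr Some; apply: le_anti.
rewrite lexI (phi_leE sw sx) (phi_leE sw sx') leIl leIr /=.
by rewrite (phi_leE sv sw) lexI -(phi_leE sv sx) -(phi_leE sv sx') leIl leIr.
Qed.

(** A projection acts as the identity wherever it is defined, because it equals
    its own [rstar], and [phi (s^* )] fixes the domain of [phi s]. *)
Lemma phi_fix_le s x z :
  rstar s = s -> phi s x = Some x -> z <= x -> phi s z = Some z.
Proof.
move=> ss sx /(phi_dom_le sx)[w /(phi_star phi_premorph)].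
by rewrite ss.
Qed.

Lemma phi_plus_le s x y z :
  phi s x = Some y -> z <= y -> phi (rplus s) z = Some z.
Proof.
by move=> /(phi_plus phi_premorph); apply: phi_fix_le; apply: (rs_star_plus A).
Qed.

Lemma phi_star_le s x y z :
  phi s x = Some y -> z <= x -> phi (rstar s) z = Some z.
Proof.
move=> /(phi_star phi_premorph); apply: phi_fix_le.
exact/proj_star/projstar.
Qed.

Lemma pap_eq a b :
  (sval a).1 = (sval b).1 -> (sval a).2 = (sval b).2 -> a = b.
Proof.
case: a b => [[y s] ha] [[y' s'] hb] /= yy' ss'.
by apply: eq_exist => /=; rewrite yy' ss'.
Qed.

Lemma pap_inv_eq a x : phi (sval a).2 x = Some (sval a).1 -> pap_inv a = x.
Proof. by apply: pbij_inj; apply: pap_invE. Qed.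

Lemma pap_mul_target a b :
  phi (sval a).2 (pap_inv a `&` (sval b).1) = Some (sval (Pmul a b)).1.
Proof. exact: (pappE (pap_mul_dom A1 a b)). Qed.

Lemma pap_mul_eq1 a b y :
  phi (sval a).2 (pap_inv a `&` (sval b).1) = Some y ->
  (sval (Pmul a b)).1 = y.
Proof. by rewrite pap_mul_target => -[]. Qed.

(** The premorphism condition [phi s (phi t v) = phi (s t) v] identifies the
    preimage under [phi t] with the source of the product. *)
Lemma pap_mul_source a b :
  phi (sval b).2 (pap_inv (Pmul a b)) = Some (pap_inv a `&` (sval b).1).
Proof.
have [v bv] := phi_ran_le (pap_invE b) (leIr (sval b).1 (pap_inv a)).
suff -> : pap_inv (Pmul a b) = v by [].
exact/pap_inv_eq/(phiM phi_premorph bv)/pap_mul_target.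
Qed.

Lemma pap_mul_le1 a b : (sval (Pmul a b)).1 <= (sval a).1.
Proof. by rewrite (phi_leE (pap_mul_target a b) (pap_invE a)) leIl. Qed.

Lemma pap_inv_mul_le a b : pap_inv (Pmul a b) <= pap_inv b.
Proof. by rewrite -(phi_leE (pap_mul_source a b) (pap_invE b)) leIr. Qed.

Lemma pap_inv_plus a : pap_inv (Pplus a) = (sval a).1.
Proof. exact/pap_inv_eq/(phi_plus phi_premorph)/pap_invE. Qed.

Lemma pap_inv_star a : pap_inv (Pstar a) = pap_inv a.
Proof. exact/pap_inv_eq/(phi_star phi_premorph)/pap_invE. Qed.

Lemma pap_plusM_target a b :
  (sval (Pmul (Pplus a) b)).1 = (sval a).1 `&` (sval b).1.
Proof.
apply: pap_mul_eq1; rewrite pap_inv_plus.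
exact: phi_plus_le (pap_invE a) (leIl _ _).
Qed.

Lemma pap_starM_target a b :
  (sval (Pmul (Pstar a) b)).1 = pap_inv a `&` (sval b).1.
Proof.
apply: pap_mul_eq1; rewrite pap_inv_star.
exact: phi_star_le (pap_invE a) (leIl _ _).
Qed.

Lemma pap_inv_mul_star a b :
  pap_inv (Pmul a (Pstar b)) = pap_inv a `&` pap_inv b.
Proof.
apply: pbij_inj (pap_mul_source a (Pstar b)) _ => /=.
exact: phi_star_le (pap_invE b) (leIr _ _).
Qed.

Lemma pap_mulA : associative Pmul.
Proof.
move=> a b c; apply: pap_eq; last exact: (rs_mulA A).
apply: pap_mul_eq1; rewrite -pap_mul_target.
have tz := phi_meet (pap_mul_source a b) (pap_mul_target b c).
(* The source of [a b] lies below that of [b] and the target of [b c] below that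
   of [b], so the middle arrow adds nothing to either meet. *)
have Es : pap_inv (Pmul a b) `&` (pap_inv b `&` (sval c).1) =
          pap_inv (Pmul a b) `&` (sval c).1.
  by rewrite meetA (meet_l (pap_inv_mul_le a b)).
have Et : (pap_inv a `&` (sval b).1) `&` (sval (Pmul b c)).1 =
          pap_inv a `&` (sval (Pmul b c)).1.
  by rewrite -meetA (meet_r (pap_mul_le1 b c)).
rewrite Es Et in tz.
have [w sw] := phi_dom_le (pap_invE a) (leIl _ (sval (Pmul b c)).1).
by rewrite sw; apply/esym/(phiM phi_premorph tz).
Qed.

Lemma pap_restriction_semigroup : restriction_semigroup Pmul Pstar Pplus.
Proof.
split=> [|a|a b|a b|a b|a|a b|a b|a b|a|a].
- exact: pap_mulA.
- apply: pap_eq; last exact: (rs_plus_mul A).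
  by rewrite pap_plusM_target meetxx.
- apply: pap_eq; last exact: (rs_plusC A).
  by rewrite !pap_plusM_target meetC.
- apply: pap_eq; last exact: (rs_plus_plusM A).
  by rewrite pap_plusM_target; apply: pap_plusM_target.
- apply: pap_eq; last exact: (rs_plusM_mul A).
  rewrite pap_plusM_target (meet_l (pap_mul_le1 a b)).
  exact/esym/pap_mul_eq1/(pap_mul_target a b).
- apply: pap_eq; last exact: (rs_mul_star A).
  by apply: pap_mul_eq1; rewrite /= meetxx pap_invE.
- apply: pap_eq; last exact: (rs_starC A).
  by rewrite !pap_starM_target meetC.
- apply: pap_eq; last exact: (rs_starM_star A).
  by rewrite pap_starM_target; apply: pap_inv_mul_star.
- apply: pap_eq; last exact: (rs_mul_starM A).
  rewrite pap_starM_target; apply: pap_mul_eq1 => /=.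
  by rewrite (meet_r (pap_inv_mul_le a b)) pap_mul_source.
- apply: pap_eq; last exact: (rs_star_plus A).
  exact: pap_inv_plus.
- by apply: pap_eq; last exact: (rs_plus_star A).
Qed.

End PartialActionProductTheory.

Theorem proposition4p7 (S : restrSemigroup)
  (d : Order.disp_t) (Y : meetSemilatticeType d)
  (q : Y -> S) (phi : S -> symInv Y)
  (q_morph : proj_morphism q)
  (phi_premorph : premorphism phi)
  (A1 : forall s : S, order_ideal (dom (phi s)) /\ order_ideal (ran (phi s)))
  (A2 : forall s : S, order_iso (phi s))
  (A3 : forall e : S, proj S e ->
     down_closure (fun x y : Y => (x <= y)%O) (q @^-1` [set e])
       `<=` dom (phi e) /\
     dom (phi e) `<=` q @^-1` down_closure (@rs_le S) [set e])
  (A4 : forall s : S, dom (phi s) `&` [set y | q y = rstar s] !=set0) :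
  restriction_semigroup
    (pap_mul q_morph phi_premorph A1 A3)
    (pap_star q_morph phi_premorph A3)
    (@pap_plus S d Y q phi phi_premorph).
Proof. exact: pap_restriction_semigroup. Qed.
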